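(* Consider the closed-loop system described in the context, with the switching controller defined as follows: fix $\Delta_{\min}=:\Delta_0<\Delta_1<\dots<\Delta_r:=\Delta_{\max}$, set $\mathcal{E}_1:=[\Delta_0,\Delta_1]$ and $\mathcal{E}_p:=(\Delta_{p-1},\Delta_p]$ for $p=2,\dots,r$, let $K_1,\dots,K_r\in\mathbb{R}^{n_u\times n_y}$ be given, and let $u[k]=K_p\tilde y[k]$ whenever $E[k]\in\mathcal{E}_p$. Let $\sigma\in(0,1]$ and $\gamma>0$. For $\bm j=(j_1,\dots,j_{n_y})\in\mathcal{J}_{n_y}$ let $\Lambda_{\bm j}:=\mathrm{diag}(\lambda_1 j_1,\dots,\lambda_{n_y}j_{n_y})$. Suppose there exist a positive definite matrix $P\in\mathbb{R}^{n_x\times n_x}$ and, for $p=1,\dots,r$ and $\bm j\in\mathcal{J}_{n_y}$, symmetric matrices with nonnegative entries $$\begin{bmatrix} L_{p,\bm j} & N_{p,\bm j}\\ N_{p,\bm j}^{\top} & M_{p,\bm j}\end{bmatrix}\in\mathbb{R}^{2n_y\times 2n_y}\quad(L_{p,\bm j},M_{p,\bm j},N_{p,\bm j}\in\mathbb{R}^{n_y\times n_y}),$$ and symmetric matrices $Z_{p,\bm j}\in\mathbb{R}^{n_y\times n_y}$, such that for every $p=1,\dots,r$ and every $\bm j\in\mathcal{J}_{n_y}$, $$\begin{bmatrix}\Gamma_{p,\bm j} & \Phi_{p,\bm j}\\ \Phi_{p,\bm j}^{\top} & \Xi_{p,\bm j}\end{bmatrix}\succ 0,$$ where $N^+_{p,\bm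 j}:=N_{p,\bm j}+N_{p,\bm j}^{\top}$, $N^-_{p,\bm j}:=N_{p,\bm j}-N_{p,\bm j}^{\top}$, $$R_{p,\bm j}:=\begin{bmatrix} L_{p,\bm j}+M_{p,\bm j}+N^+_{p,\bm j} & L_{p,\bm j}-M_{p,\bm j}-N^-_{p,\bm j}\\ (L_{p,\bm j}-M_{p,\bm j}-N^-_{p,\bm j})^{\top} & L_{p,\bm j}+M_{p,\bm j}+Z_{p,\bm j}\end{bmatrix},$$ $\Gamma_{p,\bm j}:=\mathrm{diag}(\sigma^2P,\ \gamma^2 I_{n_w},\ N^+_{p,\bm j}+Z_{p,\bm j})$, $\Xi_{p,\bm j}:=\mathrm{diag}(P,\ I_{n_z},\ R_{p,\bm j})$, and $$\Phi_{p,\bm j}:=\begin{bmatrix} A+BK_pC & BK_pD & BK_p\\ F&0&0\\ \Delta_p\Lambda_{\bm j}C & \Delta_p\Lambda_{\bm j}D & 0\\ 0&0&I_{n_y}\end{bmatrix}^{\top}\Xi_{p,\bm j}.$$ Then: (i) the closed-loop system is practically stable with an ultimate bound of the form $\eta=\rho\cdot\max_{i=1,\dots,n_y}\big((\Delta_{\max}\lambda_i+1)\bar w\|D\|_\infty+\delta_i\big)$ for some $\rho\ge 0$, i.e., for every $\bar w\ge0$, $\|w[k]\|_\infty\le\bar w$ for all $k\in\mathbb{Z}_+$ implies $\limsup_{k\to\infty}\|x[k]\|\le\eta$; (ii) the closed-loop system has decay rate $\sigma$; and (iii) its $\ell^2$-gain from $w$ to $z$ is less than or equal to $\gamma$.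
   Context: Plant (discrete time, $k\in\mathbb{Z}_+$): $x[k+1]=Ax[k]+Bu[k]$, $y[k]=Cx[k]+Dw[k]$, $z[k]=Fx[k]$, with $x[k]\in\mathbb{R}^{n_x}$, $u[k]\in\mathbb{R}^{n_u}$, $y[k]=[y_1[k],\dots,y_{n_y}[k]]^\top\in\mathbb{R}^{n_y}$, noise $w[k]\in\mathbb{R}^{n_w}$, performance output $z[k]\in\mathbb{R}^{n_z}$. Event-triggered try-once-discard protocol: fix $\Delta_{\max}>\Delta_{\min}\ge0$, $\lambda_i>0$, $\delta_i\ge0$ ($i=1,\dots,n_y$). Let $l^i_k$ be the latest time $\le k$ at which $y_i$ was transmitted (with some stored initial released value). At each $k$, compute $e_i'[k]:=y_i[l^i_{k-1}]-y_i[k]$ and $E_i':=\frac{|e_i'[k]|-\delta_i}{\lambda_i|y_i[k]|}$ (convention: $\alpha/0=+\infty$ for $\alpha>0$, $\beta/0=-\infty$ for $\beta\le0$). Rule: if $\max_iE_i'<\Delta_{\min}$, nothing is transmitted; if $\max_iE_i'\ge\Delta_{\max}$, all $y_i[k]$ with $E_i'\ge\Delta_{\max}$ are transmitted; otherwise a single $y_i[k]$ achieving $E_i'=\max_iE_i'$ is transmitted (any one if ties). If $y_i[k]$ is transmitted then $l^i_k=k$, otherwise $l^i_k=l^i_{k-1}$. Define $E[k]:=\Delta_{\min}$ if $\max_iE_i'<\Delta_{\min}$, $E[k]:=\Delta_{\max}$ if $\max_iE_i'\ge\Delta_{\max}$, and $E[k]:=\max_iE_i'$ otherwise. Let $\tilde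 y[k]:=[y_1[l^1_k],\dots,y_{n_y}[l^{n_y}_k]]^\top$; the controller is $u[k]=K(E[k])\tilde y[k]$. Notation: $\|\cdot\|$ Euclidean norm; $\|v\|_\infty=\max_i|v_i|$ and $\|D\|_\infty$ is the induced matrix norm; $\mathcal{J}_n:=\{(j_1,\dots,j_n): j_p\in\{1,-1\}\}$; $\succ0$ means symmetric positive definite; $\ell^2$ is the space of square-summable sequences on $\mathbb{Z}_+$ with $\|v\|_{\ell^2}=(\sum_k v[k]^\top v[k])^{1/2}$. Definitions: the closed-loop system is practically stable if for every $\bar w\ge0$ there is $\eta\ge0$ with $\|w[k]\|_\infty\le\bar w\ \forall k\Rightarrow\limsup_{k\to\infty}\|x[k]\|\le\eta$. It has decay rate $\sigma$ if there is $M\ge1$ such that whenever $w[k]=0$ for all $k$ and $\delta_i=0$ for all $i$, $\|x[k]\|\le M\sigma^k\|x[0]\|$ for all $k\in\mathbb{Z}_+$. Its $\ell^2$-gain (for $w\in\ell^2$) is at most $\gamma$ if, whenever $x[0]=0$ and $\delta_i=0$ for all $i$, $z\in\ell^2$ and $\|z\|_{\ell^2}\le\gamma\|w\|_{\ell^2}$. *)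

(* Defs.v *)
From HB Require Import structures.
From mathcomp Require Import all_boot all_order all_algebra.
From mathcomp Require Import reals constructive_ereal.
Set Implicit Arguments.
Unset Strict Implicit.
Unset Printing Implicit Defensive.
Import Order.TTheory GRing.Theory Num.Theory.
Local Open Scope ring_scope.

Section Defs.
Variable R : realType.

Definition enorm n (v : 'cV[R]_n) : R := Num.sqrt (\sum_(i < n) v i 0 ^+ 2).
Definition enorm2 n (v : 'cV[R]_n) : R := \sum_(i < n) v i 0 ^+ 2.
Definition vnorm_inf n (v : 'cV[R]_n) : R := \big[Num.max/0]_(i < n) `|v i 0|.
Definition mnorm_inf m n (M : 'M[R]_(m, n)) : R :=
  \big[Num.max/0]_(i < m) \sum_(j < n) `|M i j|.

Definition posdef n (M : 'M[R]_n) : Prop :=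
  M^T = M /\ forall v : 'cV[R]_n, v != 0 -> 0 < (v^T *m M *m v) 0 0.

Definition symmx n (M : 'M[R]_n) : Prop := M^T = M.

Definition diag3 a b c (X : 'M[R]_a) (Y : 'M[R]_b) (Z : 'M[R]_c)
  : 'M[R]_(a + (b + c)) := block_mx X 0 0 (block_mx Y 0 0 Z).

Definition row3 m a b c (X : 'M[R]_(m, a)) (Y : 'M[R]_(m, b)) (Z : 'M[R]_(m, c))
  : 'M[R]_(m, a + (b + c)) := row_mx X (row_mx Y Z).

(* sign vectors j in J_n are encoded as j : {ffun 'I_n -> bool}, true = +1 *)
Definition sgn (b : bool) : R := if b then 1 else -1.
Definition Lambda n (lam : 'I_n -> R) (j : {ffun 'I_n -> bool}) : 'M[R]_n :=
  \matrix_(i, i') (if i == i' then lam i * sgn (j i) else 0).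

Section Loop.
Variables (nx nu ny nw nz : nat).
Variables (A : 'M[R]_nx) (B : 'M[R]_(nx, nu)) (C : 'M[R]_(ny, nx))
          (D : 'M[R]_(ny, nw)).
Variables (Dmin Dmax : R) (lam delta : 'I_ny -> R).

(* E'_i with the conventions alpha/0 = +oo (alpha>0), beta/0 = -oo (beta<=0) *)
Definition Eprime_i (yprev y : 'cV[R]_ny) (i : 'I_ny) : \bar R :=
  let num := `|yprev i 0 - y i 0| - delta i in
  if y i 0 != 0 then (num / (lam i * `|y i 0|))%:E
  else if 0 < num then +oo%E else -oo%E.

Definition Eprime_max (yprev y : 'cV[R]_ny) : \bar R :=
  \big[Order.max/-oo%E]_(i < ny) Eprime_i yprev y i.

Definition tod_rule (yprev y : 'cV[R]_ny) (T : {set 'I_ny}) : Prop :=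
  let m := Eprime_max yprev y in
  if (m < Dmin%:E)%E then T = set0
  else if (Dmax%:E <= m)%E then T = [set i | (Dmax%:E <= Eprime_i yprev y i)%E]
  else exists i, Eprime_i yprev y i = m /\ T = [set i].

Definition Eval (yprev y : 'cV[R]_ny) : R :=
  let m := Eprime_max yprev y in
  if (m < Dmin%:E)%E then Dmin
  else if (Dmax%:E <= m)%E then Dmax else fine m.

Definition in_calE (Delta : nat -> R) (p : nat) (e : R) : Prop :=
  if p == 1%N then Delta 0%N <= e <= Delta 1%N
  else Delta p.-1 < e <= Delta p.

(* A closed-loop trajectory: state x, input u, noise w, held outputs
   yt k = tilde y[k], initial stored released values yt0, transmitted sets T. *)
Definition closed_loop (r : nat) (Delta : nat -> R) (K : nat -> 'M[R]_(nu, ny))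
  (w : nat -> 'cV[R]_nw) (x : nat -> 'cV[R]_nx) (u : nat -> 'cV[R]_nu)
  (yt : nat -> 'cV[R]_ny) (yt0 : 'cV[R]_ny) (T : nat -> {set 'I_ny}) : Prop :=
  let y k := C *m x k + D *m w k in
  let prev k := if k is k'.+1 then yt k' else yt0 in
  [/\ forall k, x k.+1 = A *m x k + B *m u k,
      forall k, tod_rule (prev k) (y k) (T k),
      forall k (i : 'I_ny), yt k i 0 = if i \in T k then y k i 0 else prev k i 0
    & forall k p, (1 <= p <= r)%N -> in_calE Delta p (Eval (prev k) (y k)) ->
        u k = K p *m yt k].
End Loop.

Section LMI.
Variables (nx nu ny nw nz : nat).
Variables (A : 'M[R]_nx) (B : 'M[R]_(nx, nu)) (C : 'M[R]_(ny, nx))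
          (D : 'M[R]_(ny, nw)) (F : 'M[R]_(nz, nx)).

Definition Rmat (L M N Z : 'M[R]_ny) : 'M[R]_(ny + ny) :=
  block_mx (L + M + (N + N^T)) (L - M - (N - N^T))
           (L - M - (N - N^T))^T (L + M + Z).

Definition Gammat (sigma gamma : R) (P : 'M[R]_nx) (N Z : 'M[R]_ny)
  : 'M[R]_(nx + (nw + ny)) :=
  diag3 (sigma ^+ 2 *: P) (gamma ^+ 2 *: (1%:M : 'M[R]_nw)) (N + N^T + Z).

Definition Ximat (P : 'M[R]_nx) (L M N Z : 'M[R]_ny)
  : 'M[R]_(nx + (nz + (ny + ny))) :=
  diag3 P (1%:M : 'M[R]_nz) (Rmat L M N Z).

Definition Gmat (Kp : 'M[R]_(nu, ny)) (Dp : R) (Lam : 'M[R]_ny)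
  : 'M[R]_(nx + (nz + (ny + ny)), nx + (nw + ny)) :=
  col_mx (row3 (A + B *m Kp *m C) (B *m Kp *m D) (B *m Kp))
   (col_mx (row3 F 0 0)
   (col_mx (row3 (Dp *: (Lam *m C)) (Dp *: (Lam *m D)) 0)
           (row3 0 0 (1%:M : 'M[R]_ny)))).

Definition Phimat (P : 'M[R]_nx) (L M N Z : 'M[R]_ny) (Kp : 'M[R]_(nu, ny))
  (Dp : R) (Lam : 'M[R]_ny) : 'M[R]_(nx + (nw + ny), nx + (nz + (ny + ny))) :=
  (Gmat Kp Dp Lam)^T *m Ximat P L M N Z.

Definition LMImat (sigma gamma : R) (P : 'M[R]_nx) (L M N Z : 'M[R]_ny)
  (Kp : 'M[R]_(nu, ny)) (Dp : R) (Lam : 'M[R]_ny) :=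
  block_mx (Gammat sigma gamma P N Z) (Phimat P L M N Z Kp Dp Lam)
           (Phimat P L M N Z Kp Dp Lam)^T (Ximat P L M N Z).
End LMI.
End Defs.

(* Main.v *)
(* With [y = C x + D w] and [e] the transmission error, the protocol gives
   [|e_i| <= Delta_p lambda_i |y_i| + delta_i] whenever [E] lies in the p-th cell.
   Choosing [j] as the sign pattern of [y] turns the bound, for [delta = 0], into
   [s - e >= 0] and [s + e >= 0] with [s = Delta_p Lambda_j y], so the nonnegative
   block matrix of [L], [M], [N] is nonnegative at [(s + e, s - e)] (S-procedure).
   A Schur complement of the LMI then gives, with [V(x) = x^T P x],
   [V(x+) + |z|^2 <= sigma^2 V(x) + gamma^2 |w|^2], hence (ii) and (iii).
   For (i), split the error relative to [C x] into a part bounded by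
   [Delta_p lambda_i |(C x)_i|] and a remainder bounded by the maximum in [eta];
   strictness of the LMI makes [V] contract up to a multiple of its square. *)
Require Import Defs.
From HB Require Import structures.
From mathcomp Require Import all_boot all_order all_algebra.
From mathcomp Require Import reals constructive_ereal.
From mathcomp Require Import ring lra.
Set Implicit Arguments.
Unset Strict Implicit.
Unset Printing Implicit Defensive.
Import Order.TTheory GRing.Theory Num.Theory.
Local Open Scope ring_scope.

(** * Bilinear forms on column vectors *)

(** Scalar-valued, so that identities between quadratic forms, once expanded, are left to [ring] and
    [lra]. *)
Definition bform {R : realType} {m n} (M : 'M[R]_(m, n)) (u : 'cV[R]_m)
  (v : 'cV[R]_n) : R := (u^T *m M *m v) 0 0.

Lemma bformDl (R : realType) m n (M : 'M[R]_(m, n)) u u' v :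
  bform M (u + u') v = bform M u v + bform M u' v.
Proof. by rewrite /bform linearD /= !mulmxDl mxE. Qed.

Lemma bformDr (R : realType) m n (M : 'M[R]_(m, n)) u v v' :
  bform M u (v + v') = bform M u v + bform M u v'.
Proof. by rewrite /bform mulmxDr mxE. Qed.

Lemma bformZl (R : realType) m n (M : 'M[R]_(m, n)) a u v :
  bform M (a *: u) v = a * bform M u v.
Proof. by rewrite /bform linearZ /= -!scalemxAl mxE. Qed.

Lemma bformZr (R : realType) m n (M : 'M[R]_(m, n)) a u v :
  bform M u (a *: v) = a * bform M u v.
Proof. by rewrite /bform -scalemxAr mxE. Qed.

Lemma bformNl (R : realType) m n (M : 'M[R]_(m, n)) u v :
  bform M (- u) v = - bform M u v.
Proof. by rewrite -scaleN1r bformZl mulN1r. Qed.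

Lemma bformNr (R : realType) m n (M : 'M[R]_(m, n)) u v :
  bform M u (- v) = - bform M u v.
Proof. by rewrite -scaleN1r bformZr mulN1r. Qed.

Lemma bformDm (R : realType) m n (M N : 'M[R]_(m, n)) u v :
  bform (M + N) u v = bform M u v + bform N u v.
Proof. by rewrite /bform mulmxDr mulmxDl mxE. Qed.

Lemma bformZm (R : realType) m n a (M : 'M[R]_(m, n)) u v :
  bform (a *: M) u v = a * bform M u v.
Proof. by rewrite /bform -scalemxAr -scalemxAl mxE. Qed.

Lemma bformNm (R : realType) m n (M : 'M[R]_(m, n)) u v :
  bform (- M) u v = - bform M u v.
Proof. by rewrite -scaleN1r bformZm mulN1r. Qed.

Lemma bform0m (R : realType) m n u v : bform (0 : 'M[R]_(m, n)) u v = 0.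
Proof. by rewrite /bform mulmx0 mul0mx mxE. Qed.

Lemma bform0r (R : realType) m n (M : 'M[R]_(m, n)) u : bform M u 0 = 0.
Proof. by rewrite /bform mulmx0 mxE. Qed.

Lemma bform_tr (R : realType) m n (M : 'M[R]_(m, n)) u v :
  bform M^T v u = bform M u v.
Proof.
have -> : bform M u v = ((u^T *m M *m v)^T) 0 0 by rewrite [RHS]mxE.
by rewrite !trmx_mul trmxK mulmxA.
Qed.

Lemma bform_mulr (R : realType) m n p (M : 'M[R]_(m, n)) (G : 'M[R]_(n, p)) u v :
  bform (M *m G) u v = bform M u (G *m v).
Proof. by rewrite /bform !mulmxA. Qed.

Lemma bform_mull (R : realType) m n p (M : 'M[R]_(m, n)) (G : 'M[R]_(m, p)) u v :
  bform (G^T *m M) u v = bform M (G *m u) v.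
Proof. by rewrite /bform trmx_mul !mulmxA. Qed.

Lemma bform_block (R : realType) m1 m2 n1 n2 (M1 : 'M[R]_(m1, n1))
    (M2 : 'M[R]_(m1, n2)) (M3 : 'M[R]_(m2, n1)) (M4 : 'M[R]_(m2, n2)) u1 u2 v1 v2 :
  bform (block_mx M1 M2 M3 M4) (col_mx u1 u2) (col_mx v1 v2) =
  bform M1 u1 v1 + bform M2 u1 v2 + (bform M3 u2 v1 + bform M4 u2 v2).
Proof.
rewrite /bform tr_col_mx -mulmxA mul_block_col mul_row_col !mulmxDr !mulmxA.
by rewrite !mxE.
Qed.

Lemma bform_sum (R : realType) m n (M : 'M[R]_(m, n)) u v :
  bform M u v = \sum_i \sum_j u i 0 * M i j * v j 0.
Proof.
rewrite /bform mxE exchange_big /=; apply: eq_bigr => j _.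
by rewrite mxE mulr_suml; apply: eq_bigr => i _; rewrite mxE.
Qed.

Lemma bform1 (R : realType) n (v : 'cV[R]_n) : bform 1%:M v v = enorm2 v.
Proof.
by rewrite /bform mulmx1 mxE; apply: eq_bigr => i _; rewrite mxE expr2.
Qed.

Lemma enorm2_ge0 (R : realType) n (v : 'cV[R]_n) : 0 <= enorm2 v.
Proof. by apply: sumr_ge0 => i _; apply: sqr_ge0. Qed.

Lemma enorm20 (R : realType) n : enorm2 (0 : 'cV[R]_n) = 0.
Proof. by rewrite /enorm2 big1 // => i _; rewrite mxE expr0n. Qed.

Lemma enorm2_col (R : realType) m n (u : 'cV[R]_m) (v : 'cV[R]_n) :
  enorm2 (col_mx u v) = enorm2 u + enorm2 v.
Proof.
rewrite /enorm2 big_split_ord /=; congr (_ + _); apply: eq_bigr => i _.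
  by rewrite col_mxEu.
by rewrite col_mxEd.
Qed.

Lemma bform_nneg (R : realType) m n (M : 'M[R]_(m, n)) (u : 'cV_m) (v : 'cV_n) :
  (forall i j, 0 <= M i j) -> (forall i, 0 <= u i 0) -> (forall j, 0 <= v j 0) ->
  0 <= bform M u v.
Proof.
move=> M0 u0 v0; rewrite bform_sum.
by apply: sumr_ge0 => i _; apply: sumr_ge0 => j _; rewrite !mulr_ge0.
Qed.

(** Each product [v i 0 * v j 0] is at most [c] in absolute value, since both squares are. *)
Lemma bform_ubound (R : realType) n (M : 'M[R]_n) (v : 'cV[R]_n) c :
  (forall i, v i 0 ^+ 2 <= c) -> bform M v v <= (\sum_i \sum_j `|M i j|) * c.
Proof.
move=> vc; rewrite bform_sum mulr_suml; apply: ler_sum => i _.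
rewrite mulr_suml; apply: ler_sum => j _.
have -> : v i 0 * M i j * v j 0 = M i j * (v i 0 * v j 0) by ring.
apply: le_trans (ler_norm _) _; rewrite normrM ler_wpM2l //.
by rewrite ler_norml; apply/andP; split; move: (vc i) (vc j); nra.
Qed.

(** * Positive definite matrices *)

Lemma posdef_ge0 (R : realType) n (M : 'M[R]_n) v : posdef M -> 0 <= bform M v v.
Proof.
move=> [_ pM]; have [->|v0] := eqVneq v 0; first by rewrite bform0r.
exact/ltW/pM.
Qed.

Lemma bform_sym (R : realType) n (M : 'M[R]_n) u v :
  M^T = M -> bform M v u = bform M u v.
Proof. by move=> sM; rewrite -{1}sM bform_tr. Qed.

(** With [a], [b], [c] the values at (v, v), (u, v), (u, u), the form at [a *: u - b *: v] equals
    [a * (a * c - b ^+ 2)]; it is nonnegative and [a] is positive. *)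
Lemma posdef_CS (R : realType) n (M : 'M[R]_n) u v : posdef M ->
  bform M u v ^+ 2 <= bform M u u * bform M v v.
Proof.
move=> pM; have [sM _] := pM.
have [->|v0] := eqVneq v 0; first by rewrite !bform0r expr0n mulr0.
have qv : 0 < bform M v v by case: pM => _; apply.
have := posdef_ge0 (bform M v v *: u - bform M u v *: v) pM.
rewrite !(bformDl, bformDr, bformNl, bformNr, bformZl, bformZr).
rewrite (bform_sym u v sM); set a := bform M v v; set b := bform M u v.
set c := bform M u u => h; rewrite -subr_ge0 -(pmulr_rge0 _ qv) -/a.
by move: h; lra.
Qed.

Lemma posdef_unit (R : realType) n (M : 'M[R]_n) : posdef M -> M \in unitmx.
Proof.
move=> [sM pM]; rewrite -row_free_unit -kermx_eq0; apply/negPn/negP.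
case/rowV0Pn=> v /sub_kermxP vM v0.
have /pM : v^T != 0 by rewrite -(inj_eq trmx_inj) trmxK trmx0.
by rewrite trmxK vM mul0mx mxE ltxx.
Qed.

(* Cauchy-Schwarz for [M] applied to [v] and the i-th column of [M^-1]. *)
Lemma posdef_coercive (R : realType) n (M : 'M[R]_n) : posdef M ->
  exists c, 0 <= c /\ forall v, enorm2 v <= c * bform M v v.
Proof.
move=> pM; have uM := posdef_unit pM; have [sM _] := pM.
pose e (i : 'I_n) : 'cV[R]_n := invmx M *m delta_mx i 0.
exists (\sum_i bform M (e i) (e i)); split.
  by apply: sumr_ge0 => i _; apply: posdef_ge0.
move=> v; rewrite mulr_suml; apply: ler_sum => i _.
apply: le_trans (posdef_CS (e i) v pM).
rewrite bform_sym // /bform /e -mulmxA mulKVmx //.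
by rewrite -colE !mxE.
Qed.

(** The form is nonnegative at [q *: u - v]; dividing by [q] bounds the cross terms. *)
Lemma posdef_young (R : realType) n (M : 'M[R]_n) u v q : posdef M -> 0 < q ->
  bform M (u + v) (u + v) <= (1 + q) * bform M u u + (1 + q^-1) * bform M v v.
Proof.
move=> pM q0; have [sM _] := pM.
have := posdef_ge0 (q *: u - v) pM.
rewrite !(bformDl, bformDr, bformNl, bformNr, bformZl, bformZr).
rewrite (bform_sym u v sM); set a := bform M v v; set b := bform M u v.
set c := bform M u u => h.
have : 0 <= q^-1 * (q * (q * c) - 2 * q * b + a).
  by rewrite mulr_ge0 ?invr_ge0 ?(ltW q0) //; move: h; lra.
have -> : q^-1 * (q * (q * c) - 2 * q * b + a) = q * c - 2 * b + q^-1 * a.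
  by field; rewrite gt_eqF.
lra.
Qed.

(** A sum of absolute values dominates each term. This merges the constants found for each cell and
    sign pattern into one. *)
Lemma finite_uniform (R : realType) (I : finType) (Q : I -> R -> Prop) :
  (forall i c c', c <= c' -> Q i c -> Q i c') ->
  (forall i, exists c, Q i c) -> exists2 c, 0 <= c & forall i, Q i c.
Proof.
move=> mono /fin_all_exists [f Qf]; exists (\sum_i `|f i|).
  by apply: sumr_ge0.
move=> i; apply: mono (Qf i); apply: le_trans (ler_norm _) _.
by rewrite (bigD1 i) //= lerDl; apply: sumr_ge0.
Qed.

(** * Transmission errors under the protocol *)

(** When [y i 0] vanishes, a finite bound rules out the value [+oo], so the numerator is
    nonpositive, which is the claim in that case. *)
Lemma Eprime_i_le (R : realType) ny (lam delta : 'I_ny -> R) (yp y : 'cV[R]_ny) i t :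
  0 < lam i -> (Eprime_i lam delta yp y i <= t%:E)%E ->
  `|yp i 0 - y i 0| <= t * lam i * `|y i 0| + delta i.
Proof.
move=> l0; rewrite /Eprime_i; case: eqVneq => [->|y0] /=; last first.
  rewrite lee_fin ler_pdivrMr ?mulr_gt0 ?normr_gt0 // => h.
  by rewrite -mulrA -lerBlDr.
by case: ltP => // h _; rewrite normr0 mulr0 add0r -subr_le0.
Qed.

Lemma Eprime_i_le_max (R : realType) ny (lam delta : 'I_ny -> R) (yp y : 'cV[R]_ny) i :
  (Eprime_i lam delta yp y i <= Eprime_max lam delta yp y)%E.
Proof. exact: le_bigmax. Qed.

Lemma Eval_bounds (R : realType) ny (Dmin Dmax : R) (lam delta : 'I_ny -> R)
    (yp y : 'cV[R]_ny) :
  Dmin <= Dmax -> Dmin <= Eval Dmin Dmax lam delta yp y <= Dmax.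
Proof.
move=> le_D; rewrite /Eval; case: (ltP _ Dmin%:E) => [_|]; first by rewrite lexx.
case: (leP Dmax%:E) => [_ _|]; first by rewrite le_D lexx.
by case: (Eprime_max _ _ _ _) => // m; rewrite lte_fin lee_fin /= => /ltW -> ->.
Qed.

(** Below [Dmin] even the maximum is under [Eval]; from [Dmax] on, an untransmitted index is below
    the threshold; in between, [Eval] is the maximum itself. *)
Lemma tod_rule_le_Eval (R : realType) ny (Dmin Dmax : R) (lam delta : 'I_ny -> R)
    (yp y : 'cV[R]_ny) T i :
  tod_rule Dmin Dmax lam delta yp y T -> i \notin T ->
  (Eprime_i lam delta yp y i <= (Eval Dmin Dmax lam delta yp y)%:E)%E.
Proof.
rewrite /tod_rule /Eval; have := Eprime_i_le_max lam delta yp y i.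
case: (ltP _ Dmin%:E) => [lt_m le_m _ _|]; first exact: ltW (le_lt_trans le_m lt_m).
case: (leP Dmax%:E) => [_ _ _ -> |]; first by rewrite inE -ltNge => /ltW.
by case: (Eprime_max _ _ _ _).
Qed.

Lemma tod_rule_error (R : realType) ny (Dmin Dmax : R) (lam delta : 'I_ny -> R)
    (yp y yt : 'cV[R]_ny) T :
  (forall i, 0 < lam i) -> (forall i, 0 <= delta i) -> 0 <= Dmin -> Dmin <= Dmax ->
  tod_rule Dmin Dmax lam delta yp y T ->
  (forall i, yt i 0 = if i \in T then y i 0 else yp i 0) ->
  forall i, `|yt i 0 - y i 0| <=
    Eval Dmin Dmax lam delta yp y * lam i * `|y i 0| + delta i.
Proof.
move=> lam0 delta0 Dmin0 le_D ruleT ytE i; rewrite ytE.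
case: ifPn => [_|iT]; last first.
  by apply: Eprime_i_le => //; apply: tod_rule_le_Eval ruleT iT.
have /andP[E0 _] := Eval_bounds lam delta yp y le_D.
by rewrite subrr normr0 addr_ge0 // !mulr_ge0 // ?(ltW (lam0 i)) // (le_trans Dmin0).
Qed.

Lemma in_calE_ex (R : realType) (Delta : nat -> R) r e :
  (0 < r)%N -> Delta 0%N <= e <= Delta r ->
  exists2 p, (1 <= p <= r)%N & in_calE Delta p e /\ e <= Delta p.
Proof.
elim: r => // r IHr _ /andP[le0 le_e].
have [le_er|lt_re] := leP e (Delta r); last first.
  exists r.+1; first by rewrite leqnn.
  split=> //; rewrite /in_calE; case: r {IHr} le_e lt_re => [|r] /= -> /=.
    by rewrite le0.
  by move=> ->.
(* With a single cell, [e] is here its left endpoint, which belongs to it because the first cell is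
   closed on the left. *)
case: r IHr le_e le_er => [_ le_e le_e0|r IHr _ le_er].
  by exists 1%N => //; split=> //; rewrite /in_calE eqxx le0.
have [||p /andP[p1 pr] pE] := IHr; rewrite ?le0 //.
by exists p; rewrite // p1 (leq_trans pr).
Qed.

Lemma Delta_le (R : realType) (Delta : nat -> R) r :
  (forall p, (p < r)%N -> Delta p < Delta p.+1) ->
  forall p q, (p <= q)%N -> (q <= r)%N -> Delta p <= Delta q.
Proof.
move=> incr p; elim=> [|q IHq]; first by rewrite leqn0 => /eqP->.
rewrite leq_eqVlt => /orP[/eqP-> //|pq qr].
by apply: le_trans (IHq pq (ltnW qr)) (ltW (incr q qr)).
Qed.

(** * From the matrix inequality to dissipation *)

(* Quadratic form of the LMI matrix at [(v, - G v)]: the Schur complement. *)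
Lemma bform_schur (R : realType) m n (Gam : 'M[R]_m) (Xi : 'M[R]_n)
    (G : 'M[R]_(n, m)) v :
  bform (block_mx Gam (G^T *m Xi) (G^T *m Xi)^T Xi)
    (col_mx v (- (G *m v))) (col_mx v (- (G *m v))) =
  bform Gam v v - bform Xi (G *m v) (G *m v).
Proof.
rewrite bform_block !(bformNl, bformNr) bform_tr bform_mull; ring.
Qed.

Lemma bform_diag3 (R : realType) a b c (X : 'M[R]_a) (Y : 'M[R]_b) (Z : 'M[R]_c) u v w :
  bform (diag3 X Y Z) (col_mx u (col_mx v w)) (col_mx u (col_mx v w)) =
  bform X u u + bform Y v v + bform Z w w.
Proof. rewrite /diag3 !bform_block !bform0m; ring. Qed.

Lemma mul_row3 (R : realType) m a b c (X : 'M[R]_(m, a)) (Y : 'M[R]_(m, b))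
    (Z : 'M[R]_(m, c)) (u : 'cV_a) (v : 'cV_b) (w : 'cV_c) :
  row3 X Y Z *m col_mx u (col_mx v w) = X *m u + Y *m v + Z *m w.
Proof. by rewrite /row3 !mul_row_col addrA. Qed.

(** The four blocks are the successor state, the output z, the error bound s and the error e. *)
Lemma Gmat_mul (R : realType) nx nu ny nw nz (A : 'M[R]_nx) (B : 'M[R]_(nx, nu))
    (C : 'M[R]_(ny, nx)) (D : 'M[R]_(ny, nw)) (F : 'M[R]_(nz, nx)) Kp Dp Lam
    (x : 'cV_nx) (w : 'cV_nw) (e : 'cV_ny) :
  Gmat A B C D F Kp Dp Lam *m col_mx x (col_mx w e) =
  col_mx (A *m x + B *m (Kp *m (C *m x + D *m w + e)))
    (col_mx (F *m x) (col_mx (Dp *: (Lam *m (C *m x + D *m w))) e)).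
Proof.
rewrite /Gmat !mul_col_mx !mul_row3 !mul0mx !(addr0, add0r) mul1mx.
by rewrite !mulmxDl !mulmxDr -!scalemxAl !scalerDr -!mulmxA !addrA.
Qed.

(* [s + e] and [s - e] are the vectors that are nonnegative when [|e| <= s]. *)
Lemma bform_Rmat (R : realType) ny (L M N Z : 'M[R]_ny) s e :
  L^T = L -> M^T = M ->
  bform (Rmat L M N Z) (col_mx s e) (col_mx s e) =
  bform (N + N^T + Z) e e +
  bform (block_mx L N N^T M) (col_mx (s + e) (s - e)) (col_mx (s + e) (s - e)).
Proof.
move=> sL sM; rewrite /Rmat !bform_block !bform_tr.
rewrite !(bformDm, bformNm, bformDl, bformDr, bformNl, bformNr, bform_tr).
rewrite (bform_sym s e sL) (bform_sym s e sM); ring.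
Qed.

(** The block [N + N^T + Z] of [Gammat] cancels against the one that [bform_Rmat] splits off,
    leaving the dissipation balance minus the S-procedure term. *)
Lemma bform_LMImat (R : realType) nx nu ny nw nz (A : 'M[R]_nx) (B : 'M[R]_(nx, nu))
    (C : 'M[R]_(ny, nx)) (D : 'M[R]_(ny, nw)) (F : 'M[R]_(nz, nx)) sigma gamma P
    L M N Z Kp Dp Lam (x : 'cV_nx) (w : 'cV_nw) (e : 'cV_ny) :
  L^T = L -> M^T = M ->
  let v := col_mx x (col_mx w e) in
  let v' := col_mx v (- (Gmat A B C D F Kp Dp Lam *m v)) in
  let y := C *m x + D *m w in
  let s := Dp *: (Lam *m y) in
  let x' := A *m x + B *m (Kp *m (y + e)) in
  bform (LMImat A B C D F sigma gamma P L M N Z Kp Dp Lam) v' v' =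
  sigma ^+ 2 * bform P x x + gamma ^+ 2 * enorm2 w - bform P x' x'
  - enorm2 (F *m x)
  - bform (block_mx L N N^T M) (col_mx (s + e) (s - e)) (col_mx (s + e) (s - e)).
Proof.
move=> sL sM v v' y s x'; rewrite /LMImat /Phimat /v' bform_schur /v Gmat_mul.
rewrite /Gammat /Ximat !bform_diag3 !bformZm !bform1 bform_Rmat //.
rewrite -/y -/s -/x'; ring.
Qed.

Definition sign_pattern {R : realType} {n} (y : 'cV[R]_n) : {ffun 'I_n -> bool} :=
  [ffun i => 0 <= y i 0].

Lemma Lambda_sign (R : realType) n (lam : 'I_n -> R) (y : 'cV[R]_n) i :
  (Lambda lam (sign_pattern y) *m y) i 0 = lam i * `|y i 0|.
Proof.
rewrite mxE (bigD1 i) //= big1 => [|j ji]; last first.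
  by rewrite mxE eq_sym (negPf ji) mul0r.
rewrite mxE eqxx ffunE addr0 -mulrA /sgn; congr (_ * _).
by case: leP => [/ger0_norm|/ltr0_norm] ->; rewrite ?mul1r ?mulN1r.
Qed.

(** Since [x] is a block of the vector at which the LMI form is evaluated, coercivity of that form
    also bounds [enorm2 x] by the loss. This is the strictness that (i) relies on. *)
Lemma LMI_dissipation (R : realType) nx nu ny nw nz (A : 'M[R]_nx)
    (B : 'M[R]_(nx, nu)) (C : 'M[R]_(ny, nx)) (D : 'M[R]_(ny, nw)) (F : 'M[R]_(nz, nx))
    sigma gamma P L M N Z Kp Dp Lam :
  symmx (block_mx L N N^T M) -> (forall a b, 0 <= block_mx L N N^T M a b) ->
  posdef (LMImat A B C D F sigma gamma P L M N Z Kp Dp Lam) ->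
  exists2 c, 0 <= c &
    forall (x : 'cV_nx) (w : 'cV_nw) (e : 'cV_ny),
  let y := C *m x + D *m w in
  let x' := A *m x + B *m (Kp *m (y + e)) in
  let loss := sigma ^+ 2 * bform P x x + gamma ^+ 2 * enorm2 w - bform P x' x'
              - enorm2 (F *m x) in
  (forall i, `|e i 0| <= (Dp *: (Lam *m y)) i 0) ->
  0 <= loss /\ enorm2 x <= c * loss.
Proof.
move=> symQ Q0 pLMI; have [c [c0 cP]] := posdef_coercive pLMI.
have [sL _ _ sM] : [/\ L^T = L, N^T^T = N, N^T = N^T & M^T = M].
  by move: symQ; rewrite /symmx tr_block_mx => /eq_block_mx[].
exists c => // x w e y x' loss le_e.
have se0 (s : 'cV_ny) : (forall i, `|e i 0| <= s i 0) ->
    forall i, 0 <= (col_mx (s + e) (s - e)) i 0.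
  move=> le_s i; rewrite -(splitK i); case: (split i) => k /=.
    by rewrite col_mxEu !mxE; move: (le_s k); rewrite ler_norml => /andP[]; lra.
  by rewrite col_mxEd !mxE; move: (le_s k); rewrite ler_norml => /andP[]; lra.
set s := Dp *: (Lam *m y) in le_e.
have q0 := bform_nneg Q0 (se0 s le_e) (se0 s le_e).
have := bform_LMImat A B C D F sigma gamma P N Z Kp Dp Lam x w e sL sM.
cbv zeta; set v := col_mx x (col_mx w e); set v' := col_mx v _.
rewrite -/y -/x' -/s -/loss => lmiE.
have le1 : bform (LMImat A B C D F sigma gamma P L M N Z Kp Dp Lam) v' v' <= loss.
  by rewrite lmiE gerBl.
split; first by apply: le_trans le1; apply: posdef_ge0.
apply: le_trans (ler_wpM2l c0 le1); apply: le_trans (cP v').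
by rewrite !enorm2_col -!addrA lerDl !addr_ge0 ?enorm2_ge0.
Qed.

(** * One closed-loop step, and tools for the ultimate bound *)

(** Reduces the protocol to an unknown error with a sector bound: the cell containing E[k] selects
    [K p], and E[k] is at most [Delta p]. *)
Lemma closed_loop_step (R : realType) nx nu ny nw (A : 'M[R]_nx) (B : 'M[R]_(nx, nu))
    (C : 'M[R]_(ny, nx)) (D : 'M[R]_(ny, nw)) lam delta r Delta K w x u yt yt0 T :
  (forall i, 0 < lam i) -> (forall i, 0 <= delta i) -> (0 < r)%N -> 0 <= Delta 0%N ->
  (forall p, (p < r)%N -> Delta p < Delta p.+1) ->
  closed_loop A B C D (Delta 0%N) (Delta r) lam delta r Delta K w x u yt yt0 T ->
  forall k, exists2 p, (1 <= p <= r)%N & exists e : 'cV_ny,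
    let y := C *m x k + D *m w k in
    x k.+1 = A *m x k + B *m (K p *m (y + e)) /\
    forall i, `|e i 0| <= Delta p * (lam i * `|y i 0|) + delta i.
Proof.
move=> lam0 delta0 r0 D0 incr [xE ruleT ytE uE] k.
have le_D : Delta 0%N <= Delta r by exact: (Delta_le incr).
set y := C *m x k + D *m w k; set prev := (if k is k'.+1 then yt k' else yt0).
have /(in_calE_ex r0)[p pr [inE le_E]] :=
  Eval_bounds lam delta prev y le_D.
exists p => //; exists (yt k - y) => /=; split.
  by rewrite xE (uE k p pr inE) [y + _]addrC subrK.
move=> i; rewrite [(yt k - y) i 0]mxE [(- y) i 0]mxE.
have := tod_rule_error lam0 delta0 D0 le_D (ruleT k) (ytE k) i.
move=> /le_trans; apply; rewrite lerD2r -mulrA ler_wpM2r //.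
by rewrite mulr_ge0 // ltW.
Qed.

(** The witness is the projection of [a] onto the interval from [- s] to [s]. *)
Lemma clamp (R : realType) (a s c : R) : 0 <= s -> `|a| <= s + c -> 0 <= c ->
  exists b, `|b| <= s /\ `|a - b| <= c.
Proof.
move=> s0; rewrite ler_norml => /andP[ha1 ha2] c0.
have [h1|h1] := leP a s; last by exists s; rewrite !ler_norml; split; lra.
have [h2|h2] := leP (- s) a; last by exists (- s); rewrite !ler_norml; split; lra.
by exists a; rewrite !ler_norml; split; lra.
Qed.

(** Induction gives a geometric bound around the fixed point [b / h]; the Bernoulli-type inequality
    [bern] makes the geometric term small at an explicit rank. *)
Lemma contraction_limsup (R : realType) (V : nat -> R) h b :
  0 < h <= 1 -> 0 <= b -> (forall k, 0 <= V k) ->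
  (forall k, V k.+1 <= (1 - h) * V k + b) ->
  forall eps, 0 < eps -> exists k0, forall k, (k0 <= k)%N -> V k <= b / h + eps.
Proof.
move=> /andP[h0 h1] b0 V0 step eps eps0.
have geo k : V k <= b / h + V 0%N * (1 - h) ^+ k.
  elim: k => [|k IHk]; first by rewrite expr0 mulr1 lerDr divr_ge0 // ltW.
  apply: le_trans (step k) _; apply: le_trans (_ : _ <=
    (1 - h) * (b / h + V 0%N * (1 - h) ^+ k) + b) _.
    by rewrite lerD2r ler_wpM2l // subr_ge0.
  rewrite exprS le_eqVlt; apply/orP; left; apply/eqP.
  by field; rewrite gt_eqF.
have bern k : (1 - h) ^+ k * (1 + k%:R * h) <= 1.
  elim: k => [|k IHk]; first by rewrite expr0 mul0r addr0 mulr1.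
  apply: le_trans IHk; rewrite exprSr -mulrA ler_wpM2l ?exprn_ge0 ?subr_ge0 //.
  have := ler0n R k; rewrite -natr1; nra.
have he : 0 < h * eps by rewrite mulr_gt0.
(* From this rank on, [V 0] is at most [k * h * eps], hence at most [eps * (1 + k * h)], and [bern]
   applies. *)
exists (Num.bound (V 0%N / (h * eps))) => k le_k.
have V0le : V 0%N <= k%:R * (h * eps).
  rewrite -ler_pdivrMr //; apply: le_trans (_ : _ <= (Num.bound (V 0%N / (h * eps)))%:R) _.
    by rewrite ltW // archi_boundP // divr_ge0 // ltW.
  by rewrite ler_nat.
apply: le_trans (geo k) _; rewrite lerD2l.
apply: le_trans (_ : _ <= eps * ((1 - h) ^+ k * (1 + k%:R * h))) _; last first.
  by rewrite -[leRHS]mulr1 ler_wpM2l // ltW.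
rewrite [_ * (1 - h) ^+ k]mulrC mulrCA ler_wpM2l ?exprn_ge0 ?subr_ge0 //.
by apply: le_trans V0le _; move: eps0; lra.
Qed.

Lemma mulmx_inf_bound (R : realType) m n (D : 'M[R]_(m, n)) (w : 'cV_n) wbar i :
  0 <= wbar -> vnorm_inf w <= wbar -> `|(D *m w) i 0| <= wbar * mnorm_inf D.
Proof.
move=> wbar0 le_w; rewrite mxE; apply: le_trans (ler_norm_sum _ _ _) _.
apply: le_trans (_ : _ <= \sum_j `|D i j| * wbar) _.
  apply: ler_sum => j _; rewrite normrM ler_wpM2l //.
  apply: le_trans le_w; exact: (le_bigmax _ (fun j => `|w j 0|) j).
rewrite -mulr_suml mulrC ler_wpM2l //.
exact: (le_bigmax _ (fun i => \sum_j `|D i j|) i).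
Qed.

Lemma enorm_le (R : realType) n (v : 'cV[R]_n) c :
  0 <= c -> enorm2 v <= c ^+ 2 -> enorm v <= c.
Proof.
move=> c0 h; rewrite /enorm -(ger0_norm c0) -sqrtr_sqr.
by rewrite ler_sqrt // sqr_ge0.
Qed.

(** * Ultimate bound, decay rate and l2-gain *)

Theorem theorem2 (R : realType) (nx nu ny nw nz : nat)
  (A : 'M[R]_nx) (B : 'M[R]_(nx, nu)) (C : 'M[R]_(ny, nx))
  (D : 'M[R]_(ny, nw)) (F : 'M[R]_(nz, nx))
  (lam delta : 'I_ny -> R)
  (r : nat) (Delta : nat -> R) (K : nat -> 'M[R]_(nu, ny))
  (sigma gamma : R) :
  (forall i, 0 < lam i) -> (forall i, 0 <= delta i) ->
  (0 < r)%N -> 0 <= Delta 0%N ->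
  (forall p, (p < r)%N -> Delta p < Delta p.+1) ->
  0 < sigma <= 1 -> 0 < gamma ->
  (exists (P : 'M[R]_nx) (L M N Z : nat -> {ffun 'I_ny -> bool} -> 'M[R]_ny),
     posdef P /\
     forall p (j : {ffun 'I_ny -> bool}), (1 <= p <= r)%N ->
       [/\ symmx (block_mx (L p j) (N p j) (N p j)^T (M p j)),
           (forall a b, 0 <= block_mx (L p j) (N p j) (N p j)^T (M p j) a b),
           symmx (Z p j)
         & posdef (LMImat A B C D F sigma gamma P (L p j) (M p j) (N p j) (Z p j)
                     (K p) (Delta p) (Lambda lam j))]) ->
  (* (i) practical stability with the stated form of ultimate bound *)
  (exists rho : R, 0 <= rho /\
     forall wbar : R, 0 <= wbar ->
     forall w x u yt yt0 T,
       closed_loop A B C D (Delta 0%N) (Delta r) lam delta r Delta K w x u yt yt0 T ->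
       (forall k, vnorm_inf (w k) <= wbar) ->
       let eta := rho * \big[Num.max/0]_(i < ny)
                    ((Delta r * lam i + 1) * wbar * mnorm_inf D + delta i) in
       forall eps : R, 0 < eps ->
         exists k0 : nat, forall k, (k0 <= k)%N -> enorm (x k) <= eta + eps)
  /\
  (* (ii) decay rate sigma (w = 0, delta = 0) *)
  (exists Mc : R, 1 <= Mc /\
     forall w x u yt yt0 T,
       closed_loop A B C D (Delta 0%N) (Delta r) lam (fun _ => 0) r Delta K w x u yt yt0 T ->
       (forall k, w k = 0) ->
       forall k, enorm (x k) <= Mc * sigma ^+ k * enorm (x 0%N))
  /\
  (* (iii) l2-gain from w to z = F x at most gamma (x[0] = 0, delta = 0) *)
  (forall w x u yt yt0 T,
     closed_loop A B C D (Delta 0%N) (Delta r) lam (fun _ => 0) r Delta K w x u yt yt0 T ->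
     x 0%N = 0 ->
     forall W : R, (forall n, \sum_(k < n) enorm2 (w k) <= W) ->
     forall n, \sum_(k < n) enorm2 (F *m x k) <= gamma ^+ 2 * W).
Proof.
move=> lam0 delta0 r0 D0 incr /andP[sigma0 sigma1] gamma0.
move=> [P [L [M [N [Z [pP LMI]]]]]].
have s2_le1 : sigma ^+ 2 <= 1 by rewrite expr_le1 // ltW.
have V0 x : 0 <= bform P x x by exact: posdef_ge0.
have [cP [cP0 hP]] := posdef_coercive pP.
set cU := \sum_i \sum_j `|P i j|.
have cU0 : 0 <= cU by apply: sumr_ge0 => i _; apply: sumr_ge0.
have hU x : bform P x x <= cU * enorm2 x.
  apply: bform_ubound => i; rewrite /enorm2 (bigD1 i) //= lerDl.
  by apply: sumr_ge0 => j _; apply: sqr_ge0.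
have [c1 c10 dissip] : exists2 c, 0 <= c & forall p, (1 <= p <= r)%N ->
    forall (x : 'cV_nx) (w : 'cV_nw) (e : 'cV_ny),
    let y := C *m x + D *m w in
    let x' := A *m x + B *m (K p *m (y + e)) in
    let loss := sigma ^+ 2 * bform P x x + gamma ^+ 2 * enorm2 w - bform P x' x'
                - enorm2 (F *m x) in
    (forall i, `|e i 0| <= Delta p * (lam i * `|y i 0|)) ->
    0 <= loss /\ enorm2 x <= c * loss.
  (* The index type contains 0, where the condition on [p] makes the property vacuous. *)
  have [||c c0 Hc] := @finite_uniform R ('I_r.+1 * {ffun 'I_ny -> bool})%type
    (fun pj c => let p := val pj.1 in (1 <= p <= r)%N ->
      forall (x : 'cV_nx) (w : 'cV_nw) (e : 'cV_ny),
      let y := C *m x + D *m w in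
      let x' := A *m x + B *m (K p *m (y + e)) in
      let loss := sigma ^+ 2 * bform P x x + gamma ^+ 2 * enorm2 w - bform P x' x'
                  - enorm2 (F *m x) in
      (forall i, `|e i 0| <= (Delta p *: (Lambda lam pj.2 *m y)) i 0) ->
      0 <= loss /\ enorm2 x <= c * loss).
  - move=> pj c c' le_c Hc p pr x w e y x' loss le_e.
    have [l0 le_x] := Hc pr x w e le_e.
    by split=> //; apply: le_trans le_x _; apply: ler_wpM2r.
  - move=> [p j] /=; have [pr|npr] := boolP (1 <= p <= r)%N; last by exists 0.
    have [symQ Q0 _ pLMI] := LMI p j pr.
    have [c _ Hc] := LMI_dissipation symQ Q0 pLMI.
    by exists c => _ x w e; apply: Hc.
  exists c => // p pr x w e y x' loss le_e.
  have ltp : (p < r.+1)%N by case/andP: pr.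
  (* The sign pattern depends on the current y, hence the need for a constant uniform in j. *)
  apply: (Hc (Ordinal ltp, sign_pattern y) pr x w e) => i.
  by rewrite mxE Lambda_sign.
split; [|split].
- have [kap kap0 Hkap] : exists2 c, 0 <= c & forall p, (p <= r)%N ->
      forall (v : 'cV_ny) b, 0 <= b -> (forall i, v i 0 ^+ 2 <= b) ->
      bform P (B *m (K p *m v)) (B *m (K p *m v)) <= c * b.
    have [||c c0 Hc] := @finite_uniform R 'I_r.+1 (fun p c =>
      forall (v : 'cV_ny) b, 0 <= b -> (forall i, v i 0 ^+ 2 <= b) ->
      bform P (B *m (K p *m v)) (B *m (K p *m v)) <= c * b).
    + move=> p c c' le_c Hc v b b0 le_v; apply: le_trans (Hc v b b0 le_v) _.
      exact: ler_wpM2r.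
    + move=> p; exists (\sum_i \sum_j `|((B *m K p)^T *m P *m (B *m K p)) i j|).
      move=> v b b0 le_v; rewrite mulmxA.
      rewrite -(bform_mulr P) -bform_mull mulmxA; exact: bform_ubound.
    by exists c => // p pr; apply: (Hc (Ordinal (pr : (p < r.+1)%N))).
  (* Strictness will give V <= beta (V - V(xa)), that is V(xa) <= (1 - q) V; adding 1 ensures q <=
     1. Young's inequality with weight [q] then yields the factor (1 + q)(1 - q) = 1 - q^2, and [a]
     collects the coefficient of the remainder. *)
  pose beta := 1 + cU * c1; pose q := beta^-1.
  have beta1 : 1 <= beta by rewrite lerDl mulr_ge0.
  have beta0 : 0 < beta by exact: lt_le_trans ltr01 beta1.
  have q0 : 0 < q by rewrite invr_gt0.
  have q1 : q <= 1 by rewrite invf_le1.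
  pose a := (1 + q^-1) * kap.
  have a0 : 0 <= a by rewrite mulr_ge0 // addr_ge0 // invr_ge0 ltW.
  have rho20 : 0 <= cP * a / q ^+ 2 by rewrite divr_ge0 ?sqr_ge0 // mulr_ge0.
  (* The limit bound on V is [a * cm ^+ 2 / q ^+ 2]; [cP] converts it to the squared norm of x. *)
  exists (Num.sqrt (cP * a / q ^+ 2)); split; first exact: sqrtr_ge0.
  move=> wbar wbar0 w x u yt yt0 T cl le_w eta eps eps0.
  have Dr0 : 0 <= Delta r by apply: le_trans D0 _; apply: (Delta_le incr).
  set cm := (X in _ * X) in eta *.
  have le_cm i : (Delta r * lam i + 1) * wbar * mnorm_inf D + delta i <= cm.
    exact: (le_bigmax _ (fun i => (Delta r * lam i + 1) * wbar * mnorm_inf D + delta i) i).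
  have cm0 : 0 <= cm by exact: bigmax_ge_id.
  have step k : bform P (x k.+1) (x k.+1) <=
      (1 - q ^+ 2) * bform P (x k) (x k) + a * cm ^+ 2.
    have [p pr [e [xE le_e]]] :=
      closed_loop_step lam0 delta0 r0 D0 incr cl k.
    have [p1 p_r] := andP pr.
    have Dp0 : 0 <= Delta p.
      by apply: le_trans D0 _; apply: (Delta_le incr).
    have Dpr : Delta p <= Delta r by apply: (Delta_le incr).
    (* The total deviation D w + e from C x is clamped to the sector of C x. The excess is at most
       [cm], as |y_i| <= |(C x)_i| + |(D w)_i|. *)
    have /fin_all_exists[f Hf] i : exists b : R,
        `|b| <= Delta p * (lam i * `|(C *m x k) i 0|) /\
        `|(D *m w k) i 0 + e i 0 - b| <= cm.
      apply: clamp => //; first by rewrite !mulr_ge0 // ltW.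
      apply: le_trans (ler_normD _ _) _.
      have dw := mulmx_inf_bound D i wbar0 (le_w k).
      have := le_e i; rewrite [(C *m x k + _) i 0]mxE => le_ei.
      have dw0 := normr_ge0 ((D *m w k) i 0).
      have le_y := ler_normD ((C *m x k) i 0) ((D *m w k) i 0).
      have lp : Delta p * lam i <= Delta r * lam i by rewrite ler_wpM2r // ltW.
      have lp0 : 0 <= Delta p * lam i by rewrite mulr_ge0 // ltW.
      have m1 := ler_wpM2l lp0 le_y.
      have m2 := ler_wpM2r dw0 lp.
      have m3 : 0 <= Delta r * lam i + 1 by rewrite addr_ge0 // mulr_ge0 // ltW.
      have := ler_wpM2l m3 dw; have := le_cm i; lra.
    pose e1 : 'cV[R]_ny := \col_i f i.
    pose e2 : 'cV[R]_ny := D *m w k + e - e1.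
    (* Dissipation is applied to the noise-free step with error [e1], whose successor is [xa]; noise
       enters only through [e2]. *)
    have [] := dissip p pr (x k) 0 e1.
      by move=> i; rewrite mulmx0 addr0 mxE; case: (Hf i).
    rewrite mulmx0 addr0.
    set xa := A *m x k + B *m (K p *m (C *m x k + e1)).
    rewrite enorm20.
    have -> : x k.+1 = xa + B *m (K p *m e2).
      rewrite xE /xa -[RHS]addrA -!mulmxDr; congr (_ + _ *m (_ *m _)).
      by rewrite /e2 -[RHS]addrA [e1 + _]addrC subrK addrA.
    set l := (X in 0 <= X) => l0 le_x.
    have le_xa : bform P xa xa <= (1 - q) * bform P (x k) (x k).
      have ll : l <= bform P (x k) (x k) - bform P xa xa.
        have := enorm2_ge0 (F *m x k).
        have := ler_wpM2r (V0 (x k)) s2_le1; rewrite /l; lra.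
      have : bform P (x k) (x k) <= beta * (bform P (x k) (x k) - bform P xa xa).
        apply: le_trans (ler_wpM2l (ltW beta0) ll); apply: le_trans (hU _) _.
        apply: le_trans (ler_wpM2l cU0 le_x) _; rewrite mulrA.
        by apply: ler_wpM2r => //; rewrite /beta; lra.
      by rewrite mulrC -ler_pdivrMr // -/q; lra.
    have e2_le i : e2 i 0 ^+ 2 <= cm ^+ 2.
      rewrite -(real_normK (num_real (e2 i 0))) ler_sqr ?nnegrE //.
      have [_] := Hf i; congr (_ <= _).
      by rewrite /e2 [(_ - e1) i 0]mxE [(- e1) i 0]mxE [(_ + e) i 0]mxE [e1 i 0]mxE.
    apply: le_trans (posdef_young _ _ pP q0) _.
    apply: lerD.
      apply: le_trans (ler_wpM2l (_ : 0 <= 1 + q) le_xa) _; first by lra.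
      by rewrite mulrA; apply: ler_wpM2r => //; lra.
    rewrite /a -[leRHS]mulrA; apply: ler_wpM2l.
      by rewrite addr_ge0 // invr_ge0 ltW.
    by apply: Hkap => //; apply: sqr_ge0.
  have q2 : 0 < q ^+ 2 <= 1 by rewrite exprn_gt0 // expr_le1 // ltW.
  (* Dividing by [cP + 1] rather than [cP] stays valid when [cP] is 0. *)
  have eps' : 0 < eps ^+ 2 / (cP + 1).
    by rewrite divr_gt0 ?exprn_gt0 // ltr_wpDl.
  have [k0 Hk0] := @contraction_limsup R (fun k => bform P (x k) (x k)) _ _ q2
    (mulr_ge0 a0 (sqr_ge0 cm)) (fun k => V0 (x k)) step _ eps'.
  exists k0 => k /Hk0 le_V.
  have eta0 : 0 <= eta by rewrite mulr_ge0 // sqrtr_ge0.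
  apply: enorm_le; first by rewrite addr_ge0 // ltW.
  apply: le_trans (hP _) _; apply: le_trans (ler_wpM2l cP0 le_V) _.
  have -> : cP * (a * cm ^+ 2 / q ^+ 2 + eps ^+ 2 / (cP + 1)) =
            eta ^+ 2 + cP / (cP + 1) * eps ^+ 2.
    rewrite /eta exprMn sqr_sqrtr //.
    by field; rewrite (gt_eqF q0) gt_eqF // ltr_wpDl.
  have le_eps : cP / (cP + 1) * eps ^+ 2 <= eps ^+ 2.
    rewrite -[leRHS]mul1r; apply: ler_wpM2r; first exact: sqr_ge0.
    by rewrite ler_pdivrMr ?ltr_wpDl // mul1r lerDl.
  have := mulr_ge0 eta0 (ltW eps0); lra.
(* Comparing V with the squared norm on both sides gives the squared constant [cP * cU], which (1 +
   cP cU)^2 dominates. *)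
- exists (1 + cP * cU); split; first by rewrite lerDl mulr_ge0.
  move=> w x u yt yt0 T cl w0 k.
  have Vk : bform P (x k) (x k) <= (sigma ^+ k) ^+ 2 * bform P (x 0%N) (x 0%N).
    elim: k => [|k IHk]; first by rewrite expr0 expr1n mul1r.
    have [p pr [e [xE le_e]]] := closed_loop_step lam0 (fun=> lexx 0) r0 D0 incr cl k.
    have [|+ _] := dissip p pr (x k) (w k) e.
      by move=> i; have := le_e i; rewrite addr0.
    rewrite -xE w0.
    rewrite enorm20.
    have := enorm2_ge0 (F *m x k).
    have := ler_wpM2l (sqr_ge0 sigma) IHk.
    rewrite mulrA -exprMn -exprS; lra.
  have s0 : 0 <= sigma ^+ k by rewrite exprn_ge0 // ltW.
  have c0 : 0 <= cP * cU by rewrite mulr_ge0.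
  apply: enorm_le; first by rewrite !mulr_ge0 ?sqrtr_ge0 // addr_ge0.
  rewrite 2!exprMn sqr_sqrtr ?enorm2_ge0 //.
  apply: le_trans (hP _) _; apply: le_trans (ler_wpM2l cP0 Vk) _.
  apply: le_trans (ler_wpM2l cP0 (ler_wpM2l (sqr_ge0 _) (hU _))) _.
  have -> : cP * ((sigma ^+ k) ^+ 2 * (cU * enorm2 (x 0%N))) =
    cP * cU * (sigma ^+ k) ^+ 2 * enorm2 (x 0%N) by ring.
  do 2![apply: ler_wpM2r; first by rewrite ?enorm2_ge0 ?sqr_ge0].
  by have := sqr_ge0 (cP * cU); lra.
- move=> w x u yt yt0 T cl x0 W le_W n.
  (* Keeping V(x n) on the left makes the dissipation inequalities telescope, using sigma^2 <= 1. *)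
  suff : bform P (x n) (x n) + \sum_(k < n) enorm2 (F *m x k) <=
         gamma ^+ 2 * \sum_(k < n) enorm2 (w k).
    have := ler_wpM2l (sqr_ge0 gamma) (le_W n); have := V0 (x n); lra.
  elim: n => [|n IHn]; first by rewrite !big_ord0 x0 bform0r mulr0 addr0.
  rewrite !big_ord_recr /=.
  have [p pr [e [xE le_e]]] := closed_loop_step lam0 (fun=> lexx 0) r0 D0 incr cl n.
  have [|+ _] := dissip p pr (x n) (w n) e.
    by move=> i; have := le_e i; rewrite addr0.
  rewrite -xE; have := ler_wpM2r (V0 (x n)) s2_le1; move: IHn; lra.
Qed.
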